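(* For any $c \ge 1$, any streaming algorithm in the node-arrival model that makes $O(1)$ passes and, with probability of error at most $0.49$, computes a $(c,0)$-approximation of the cost of the optimal correlation clustering of the induced graph on $n$ nodes requires $\Omega(n)$ bits of space.
   Context: Node-arrival stream model: the stream consists of the $n$ objects (nodes); a fixed pairwise similarity function determines for any two nodes whether they are similar ($+1$ edge) or dissimilar ($-1$ edge), and it can be evaluated on nodes stored in memory. The induced graph is the complete graph on the nodes with these $\pm1$ labels. The cost of a clustering (partition of the nodes) is the number of $+1$ edges between different clusters plus the number of $-1$ edges inside clusters; the optimal cost is the minimum over all partitions. An estimate $\tilde X$ is a $(c,d)$-approximation of $X$ if $X \le \tilde X \le cX+d$; a $(c,0)$-approximation thus satisfies $X \le \tilde X \le cX$. A ''$0.49$-error'' algorithm outputs a correct approximation with probability at least $0.51$. *)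

(* Defs.v *)
From HB Require Import structures.
From mathcomp Require Import all_boot all_order all_algebra.
From mathcomp Require Import reals.

Set Implicit Arguments.
Unset Strict Implicit.
Unset Printing Implicit Defensive.

Import Order.TTheory GRing.Theory Num.Theory.
Local Open Scope ring_scope.

Section CorrelationClustering.
Variables (T : finType) (sim : rel T).

(* Edges are unordered pairs of distinct nodes, encoded as 2-element sets. *)
Definition edges (V : {set T}) : {set {set T}} :=
  [set e : {set T} | (e \subset V) && (#|e| == 2)].

(* The diagonal of sim is irrelevant: only distinct endpoints are compared. *)
Definition plus_edge (e : {set T}) : bool :=
  [forall x in e, forall y in e, (x != y) ==> sim x y].

Definition inside (P : {set {set T}}) (e : {set T}) : bool :=
  [exists C in P, e \subset C].

Definition cluster_cost (V : {set T}) (P : {set {set T}}) : nat :=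
  (#|[set e in edges V | plus_edge e && ~~ inside P e]| +
   #|[set e in edges V | ~~ plus_edge e && inside P e]|)%N.

Definition singletons (V : {set T}) : {set {set T}} := [set [set x] | x in V].

(* The partition into singletons only serves to witness that the range of the
   minimum is nonempty, see opt_cost_le and opt_cost_attained. *)
Definition opt_cost (V : {set T}) : nat :=
  cluster_cost V [arg min_(P < singletons V | partition P V) cluster_cost V P].

Lemma singletons_partition (V : {set T}) : partition (singletons V) V.
Proof.
apply/and3P; split.
- rewrite /cover; apply/eqP/setP => x; apply/bigcupP/idP => [[C]|xV].
    by case/imsetP => y yV -> /set1P ->.
  by exists [set x]; rewrite ?set11 //; apply: imset_f.
- apply/trivIsetP => A B /imsetP[x _ ->] /imsetP[y _ ->] xy.
  rewrite disjoints1 inE; apply: contra xy => /eqP ->; exact: eqxx.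
- by apply/imsetP => -[x _ /setP /(_ x)]; rewrite !inE eqxx.
Qed.

Lemma opt_cost_le (V : {set T}) (P : {set {set T}}) :
  partition P V -> (opt_cost V <= cluster_cost V P)%N.
Proof.
move=> PV; rewrite /opt_cost; case: arg_minnP => [|Q _]; last exact.
exact: singletons_partition.
Qed.

Lemma opt_cost_attained (V : {set T}) :
  exists2 P, partition P V & opt_cost V = cluster_cost V P.
Proof.
rewrite /opt_cost; case: arg_minnP => [|Q QV _]; last by exists Q.
exact: singletons_partition.
Qed.

End CorrelationClustering.

Definition approximates (R : realType) (c d X Xt : R) : bool :=
  (X <= Xt) && (Xt <= c * X + d).

(* A multi-pass randomized streaming algorithm whose stream items are objects of
   a universe T and whose working memory consists of [space_bits] bits.
   - The similarity function is fixed in advance, so every component receives it.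
     The algorithm does not know which objects of T are in the stream: sim can be
     used on stream objects only as far as these are recoverable from the memory
     (or are the object being read).
   - The random seed is readable at all times and is not charged to the space,
     nor is the clock (the nat argument of [step]), which counts the objects read
     so far over all passes; the lower bound thus covers algorithms that have
     to keep these in memory. *)
Record stream_alg (R : realType) (T : finType) := StreamAlg {
  space_bits : nat;
  passes : nat;
  seed : finType;
  seed_prob : seed -> R;
  seed_prob_ge0 : forall w, 0 <= seed_prob w;
  seed_prob_sum1 : \sum_w seed_prob w = 1;
  init : rel T -> seed -> space_bits.-tuple bool;
  step : rel T -> seed -> nat -> T -> space_bits.-tuple bool -> space_bits.-tuple bool;
  output : rel T -> seed -> space_bits.-tuple bool -> R
}.

Section Run.
Variables (R : realType) (T : finType) (A : stream_alg R T) (sim : rel T).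

Definition final_memory (w : seed A) (st : seq T) : (space_bits A).-tuple bool :=
  let inputs := flatten (nseq (passes A) st) in
  foldl (fun m tx => step sim w tx.1 tx.2 m) (init sim w)
        (zip (iota 0 (size inputs)) inputs).

Definition estimate (w : seed A) (st : seq T) : R :=
  output sim w (final_memory w st).

Definition error_prob (c d : R) (st : seq T) : R :=
  \sum_(w : seed A |
        ~~ approximates c d (opt_cost sim [set x in st])%:R (estimate w st))
     seed_prob w.

End Run.

(* Main.v *)
(** The lower bound comes from disjointness of two k-bit vectors, k = n / 2.
    Alice inserts one of two nodes for each bit x_j, Bob one of two nodes for
    each bit y_j; all pairs are similar except the two nodes standing for
    x_j = 1 and y_j = 1. The optimal cost is 0 iff x and y are disjoint, and an
    estimate with ratio c separates cost 0 from positive cost for every c. The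
    memory states at the two halves of each pass form a transcript with at most
    2^(2 s p) values whose fibres are rectangles.

    Disjointness is hard by a cut-and-paste argument in Hellinger distance: let
    z be uniform and let d say, for each coordinate, which party receives z_j,
    the other one receiving 0. Planting (a, b) at coordinate i gives transcript
    laws P_ab, and the rectangle property yields P_00 P_11 = P_01 P_10, hence
    h(P_00, P_11) = h(P_01, P_10) is bounded by h(P_00, P_01) and h(P_00, P_10).
    For fixed d the latter compare the conditional laws of a function of z given
    z_i = 0 and z_i = 1; the level-1 inequality bounds their sum over i by the
    logarithm of the number of transcripts. *)

Require Import Defs.
From HB Require Import structures.
From mathcomp Require Import all_boot all_order all_algebra.
From mathcomp Require Import reals.
From mathcomp.analysis Require Import sequences exp.
From mathcomp Require Import zify ring lra.

Set Implicit Arguments.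
Unset Strict Implicit.
Unset Printing Implicit Defensive.

Import Order.TTheory GRing.Theory Num.Theory.
Local Open Scope ring_scope.

(** * Level-1 inequality on the Boolean cube *)

Section Cube.
Variables (R : realType) (I : finType).
Local Notation cube := {ffun I -> bool}.
Implicit Types (z d : cube) (i : I).

Definition upd z i (b : bool) : cube := [ffun j => if j == i then b else z j].

Definition sgn (b : bool) : R := if b then -1 else 1.

Lemma upd_id z i : upd z i (z i) = z.
Proof. by apply/ffunP => j; rewrite ffunE; case: eqP => // ->. Qed.

(** Flipping coordinate [i] is an involution, and the two updates of [z] are [z] itself and its
    flip. *)
Lemma sum_upd (G : cube -> R) i :
  \sum_z (G (upd z i false) + G (upd z i true)) = 2 * \sum_z G z.
Proof.
have flipK : involutive (fun z => upd z i (~~ z i)).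
  by move=> z; apply/ffunP => j; rewrite !ffunE eqxx negbK; case: eqP => // ->.
transitivity (\sum_z (G z + G (upd z i (~~ z i)))).
  apply: eq_bigr => z _; rewrite -{3}(upd_id z i).
  by case: (z i); rewrite // addrC.
rewrite big_split /= mulr_natl mulr2n; congr (_ + _).
by rewrite [RHS](reindex_inj (inv_inj flipK)).
Qed.

(** With [x = b / 4], the bound [e^x <= 1 + x + 2 x^2] at [x] and [-x] gives a sum of at most
    [2 + b^2 / 4], hence at most [2 e^(b^2 / 8)]. *)
Lemma expR_pm_le2 (b : R) : -1 <= b <= 1 ->
  expR (4^-1 * b - 8^-1 * b ^+ 2) + expR (- (4^-1 * b) - 8^-1 * b ^+ 2) <= 2.
Proof.
move=> b1.
have half (x : R) : -1 <= 4 * x <= 1 -> expR x <= 1 + x + 2 * x ^+ 2.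
  (* This is [1 - x <= e^(-x)]; then [(1 - x)(1 + x + 2 x^2) = 1 + x^2 (1 - 2 x) >= 1]. *)
  move=> x1; have : (1 - x) * expR x <= 1.
    rewrite -[leRHS](expRxMexpNx_1 x) mulrC ler_wpM2l ?expR_ge0 //.
    exact: expR_ge1Dx.
  move=> h; have p1 : 0 < 1 - x by lra.
  rewrite -(ler_pM2l p1); apply: (le_trans h).
  have : 0 <= x ^+ 2 * (1 - 2 * x) by rewrite mulr_ge0 ?sqr_ge0 //; lra.
  by rewrite -[1 <= _]subr_ge0; congr (_ <= _); ring.
rewrite !expRD (expRN (_ * _ ^+ 2)) -mulrDl ler_pdivrMr ?expR_gt0 //.
have h1 := half (4^-1 * b) ltac:(lra).
have h2 := half (- (4^-1 * b)) ltac:(lra).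
have := expR_ge1Dx (8^-1 * b ^+ 2).
move: h1 h2; rewrite sqrrN !exprMn; lra.
Qed.

Section Level1.
Variables (F : finType) (M : cube -> F).

Definition fibre (m : F) : R := \sum_z (M z == m)%:R.
(** The law of [M z] given [z i = b], scaled to the same total mass [#|{: cube}|] as [fibre]. *)
Definition fibre_at i (b : bool) (m : F) : R := \sum_z (M (upd z i b) == m)%:R.
(** The unnormalised level-1 Fourier coefficient of the indicator of the fibre over [m]. *)
Definition bias i (m : F) : R := \sum_z (M z == m)%:R * sgn (z i).

Lemma fibre_ge0 m : 0 <= fibre m.
Proof. by apply: sumr_ge0 => z _. Qed.

Lemma fibre_at_ge0 i b m : 0 <= fibre_at i b m.
Proof. by apply: sumr_ge0 => z _. Qed.

Lemma norm_bias i m : `|bias i m| <= fibre m.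
Proof.
apply: (le_trans (ler_norm_sum _ _ _)); apply: ler_sum => z _.
by rewrite normrM normr_nat /sgn; case: (z i); rewrite ?normrN normr1 mulr1.
Qed.

Lemma fibre_atD i m : fibre_at i false m + fibre_at i true m = 2 * fibre m.
Proof. by rewrite -(sum_upd (fun z => (M z == m)%:R) i) big_split. Qed.

Lemma fibre_atB i m : fibre_at i false m - fibre_at i true m = 2 * bias i m.
Proof.
rewrite -(sum_upd (fun z => (M z == m)%:R * sgn (z i)) i) -sumrB.
by apply: eq_bigr => z _; rewrite !ffunE eqxx /= mulr1 mulrN1.
Qed.

Lemma sum_fibreM (g : F -> cube -> R) :
  \sum_z g (M z) z = \sum_m \sum_z (M z == m)%:R * g m z.
Proof.
rewrite exchange_big /=; apply: eq_bigr => z _.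
rewrite (bigD1 (M z)) //= eqxx mul1r big1 ?addr0 // => m.
by rewrite eq_sym => /negPf ->; rewrite mul0r.
Qed.

Lemma card_cube : \prod_(i : I) (2 : R) = #|{: cube}|%:R.
Proof. by rewrite prodr_const card_ffun card_bool natrX. Qed.

(* The level-1 inequality: [expR (g m z)] has mean at most 1 for each [m], so
   convexity bounds the mean of [g (M z) z] by [ln #|F|]. *)
Lemma level1 (L : R) : #|F|%:R <= expR L ->
  \sum_i \sum_m bias i m ^+ 2 / fibre m <= 8 * #|{: cube}|%:R * L.
Proof.
move=> FL; pose b i m := bias i m / fibre m.
(* An empty fibre is covered too: there [bias] vanishes by [norm_bias]. *)
have biasE i m : bias i m = fibre m * b i m.
  rewrite /b; have [f0|f0] := eqVneq (fibre m) 0; last by field.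
  by apply/eqP; rewrite f0 mul0r -normr_le0 -f0 norm_bias.
have b1 i m : -1 <= b i m <= 1.
  rewrite -ler_norml /b normrM normfV (ger0_norm (fibre_ge0 m)).
  have [->|f0] := eqVneq (fibre m) 0; first by rewrite invr0 mulr0.
  by rewrite ler_pdivrMr ?mul1r ?norm_bias // lt0r f0 fibre_ge0.
(* Averaged over the fibre of [m], [g m] is the sum over [i] of [(1/4 - 1/8) b i m ^+ 2], which
   explains the factor 8. *)
pose g m z : R := \sum_i (4^-1 * b i m * sgn (z i) - 8^-1 * b i m ^+ 2).
(* The exponential is a product over coordinates, so the sum over the cube factors. *)
have exp_g m : \sum_z expR (g m z) <= #|{: cube}|%:R.
  rewrite -card_cube.
  pose h i (c : bool) := expR (4^-1 * b i m * sgn c - 8^-1 * b i m ^+ 2).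
  rewrite (eq_bigr (fun z : cube => \prod_i h i (z i))); last first.
    by move=> z _; rewrite expR_sum.
  rewrite -(bigA_distr_bigA h); apply: ler_prod => i _.
  rewrite sumr_ge0 /=; last by move=> c _; exact: expR_ge0.
  rewrite big_bool /h /sgn /= mulrN1 mulr1 addrC.
  exact: expR_pm_le2.
have sum_g : \sum_z g (M z) z <= #|{: cube}|%:R * L.
  have : \sum_z (1 + (g (M z) z - L)) <= #|{: cube}|%:R.
    apply: (@le_trans _ _ (\sum_z expR (g (M z) z - L))).
      by apply: ler_sum => z _; exact: expR_ge1Dx.
    under eq_bigr do rewrite expRD expRN.
    rewrite -mulr_suml ler_pdivrMr ?expR_gt0 //.
    rewrite (sum_fibreM (fun m z => expR (g m z))).
    apply: (@le_trans _ _ (\sum_(m : F) #|{: cube}|%:R)).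
      apply: ler_sum => m _; apply: le_trans (exp_g m); apply: ler_sum => z _.
      by rewrite ler_piMl ?expR_ge0 // lern1 leq_b1.
    by rewrite sumr_const -[X in X <= _]mulr_natr ler_wpM2l.
  rewrite big_split sumrB /= !sumr_const -[L *+ _]mulr_natl -[1 *+ _]/(#|_|%:R).
  lra.
rewrite exchange_big /=.
suff -> : \sum_m \sum_i bias i m ^+ 2 / fibre m = 8 * \sum_z g (M z) z.
  by rewrite -mulrA ler_pM2l.
rewrite sum_fibreM mulr_sumr; apply: eq_bigr => m _.
rewrite /g; under [X in _ = 8 * X]eq_bigr do rewrite mulr_sumr.
rewrite exchange_big mulr_sumr; apply: eq_bigr => i _ /=.
transitivity (8 * (4^-1 * b i m * bias i m - 8^-1 * b i m ^+ 2 * fibre m)).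
  rewrite biasE; have [->|f0] := eqVneq (fibre m) 0; first by ring.
  by field.
congr (_ * _); rewrite !mulr_sumr -sumrB.
by apply: eq_bigr => z _; ring.
Qed.

(** Squared Hellinger distance without the factor 1/2, for laws of arbitrary total mass. *)
Definition hellinger (P Q : F -> R) : R :=
  \sum_m (Num.sqrt (P m) - Num.sqrt (Q m)) ^+ 2.

(** Termwise, [(sqrt P - sqrt Q)^2 <= (P - Q)^2 / (P + Q)], where [P + Q] is twice the fibre and
    [P - Q] twice the bias; [level1] bounds the sum. *)
Lemma hellinger_fibre_at_le (L : R) : #|F|%:R <= expR L ->
  \sum_i hellinger (fibre_at i false) (fibre_at i true) <=
    16 * #|{: cube}|%:R * L.
Proof.
move=> FL.
have -> : 16 * #|{: cube}|%:R * L = 2 * (8 * #|{: cube}|%:R * L) by ring.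
apply: (@le_trans _ _ (2 * \sum_i \sum_m bias i m ^+ 2 / fibre m)); last first.
  by rewrite ler_pM2l // level1.
rewrite mulr_sumr; apply: ler_sum => i _; rewrite mulr_sumr.
apply: ler_sum => m _.
have := fibre_atB i m; have := fibre_atD i m.
have := sqrtr_ge0 (fibre_at i false m); have := sqrtr_ge0 (fibre_at i true m).
have := sqr_sqrtr (fibre_at_ge0 i false m).
have := sqr_sqrtr (fibre_at_ge0 i true m).
set P := fibre_at _ _ _; set Q := fibre_at _ _ _.
set u := Num.sqrt P; set v := Num.sqrt Q => <- <- u0 v0 D B.
have [f0|f0] := eqVneq (fibre m) 0.
  rewrite f0 invr0 !mulr0; nra.
have fp : 0 < fibre m by rewrite lt0r f0 fibre_ge0.
rewrite mulrA ler_pdivlMr //.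
have : (v - u) ^+ 2 * (v + u) ^+ 2 = (2 * bias i m) ^+ 2 by rewrite -B; ring.
have : 0 <= (v - u) ^+ 2 * (u * v) by rewrite mulr_ge0 ?sqr_ge0 ?mulr_ge0.
move=> h1 h2; have -> : fibre m = (v ^+ 2 + u ^+ 2) / 2 by rewrite D; field.
have -> : 2 * bias i m ^+ 2 = (v - u) ^+ 2 * (v + u) ^+ 2 / 2.
  by rewrite h2; field.
by rewrite -subr_ge0; move: h1; congr (_ <= _); field.
Qed.

End Level1.

(** * Cut-and-paste for functions with rectangular fibres *)

Section CutAndPaste.
Variables (F : finType) (f : cube -> cube -> F).
Hypothesis rect : forall x y x' y', f x y = f x' y' -> f x y' = f x y.

Definition masked d z : cube := [ffun j => d j && z j].
Definition neg d : cube := [ffun j => ~~ d j].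
Definition mix d z z' : cube := [ffun j => if d j then z j else z' j].

(* The coordinates of [z] selected by [d] go to the first argument, the others
   to the second one, and the pair [(a, b)] is planted at coordinate [i]. *)
Definition hard_output d i (a b : bool) z : F :=
  f (upd (masked d z) i a) (upd (masked (neg d) z) i b).
Definition hard_fibre d i a b (m : F) : R :=
  \sum_z (hard_output d i a b z == m)%:R.
Definition masked_output d z : F := f (masked d z) (masked (neg d) z).

(** If [d i] is true, Bob holds 0 at [i] anyway, so planting [(a, 0)] amounts to setting [z i] to
    [a]. *)
Lemma hard_fibre_alice d i a :
  hard_fibre d i a false =1 fibre_at (masked_output (upd d i true)) i a.
Proof.
move=> m; apply: eq_bigr => z _; rewrite /hard_output /masked_output.
congr ((f _ _ == m)%:R); apply/ffunP => j; rewrite !ffunE; by case: eqP.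
Qed.

Lemma hard_fibre_bob d i b :
  hard_fibre d i false b =1 fibre_at (masked_output (upd d i false)) i b.
Proof.
move=> m; apply: eq_bigr => z _; rewrite /hard_output /masked_output.
congr ((f _ _ == m)%:R); apply/ffunP => j; rewrite !ffunE; by case: eqP.
Qed.

Lemma hard_fibre_ge0 d i a b m : 0 <= hard_fibre d i a b m.
Proof. by apply: sumr_ge0 => z _. Qed.

Lemma sum_hard_fibre d i a b (w : F -> R) :
  \sum_m w m * hard_fibre d i a b m = \sum_z w (hard_output d i a b z).
Proof.
rewrite (sum_fibreM (hard_output d i a b) (fun m _ => w m)).
apply: eq_bigr => m _; rewrite mulr_sumr.
by apply: eq_bigr => z _; rewrite mulrC.
Qed.

(** Each product counts pairs of inputs with both outputs [m]; on a rectangle, exchanging the second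
    arguments preserves both outputs. *)
Lemma cut_paste d i a b a' b' m :
  hard_fibre d i a b m * hard_fibre d i a' b' m =
  hard_fibre d i a b' m * hard_fibre d i a' b m.
Proof.
(* Exchange between [z] and [z'] the coordinates outside [d]. *)
pose swap (u : cube * cube) := (mix d u.1 u.2, mix d u.2 u.1).
have swapK : involutive swap.
  by case=> z z'; congr (_, _); apply/ffunP => j; rewrite !ffunE; case: (d j).
rewrite /hard_fibre !big_distrlr /= !pair_big /=.
rewrite (reindex_inj (inv_inj swapK)) /=; apply: eq_bigr => -[z z'] _ /=.
have maskl u v : masked d (mix d u v) = masked d u.
  by apply/ffunP => j; rewrite !ffunE; case: (d j).
have maskr u v : masked (neg d) (mix d u v) = masked (neg d) v.
  by apply/ffunP => j; rewrite !ffunE; case: (d j).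
rewrite -!natrM !mulnb /hard_output !maskl !maskr.
congr ((_ : bool)%:R).
by apply/andP/andP => -[/eqP h1 /eqP h2]; split; apply/eqP;
  [rewrite -h1 | rewrite -h2 | rewrite -h1 | rewrite -h2]; apply: rect;
  [exact: etrans h1 (esym h2) | exact: etrans h2 (esym h1)
  |exact: etrans h1 (esym h2) | exact: etrans h2 (esym h1)].
Qed.

(** All laws have equal mass, so the distance depends only on the sum of [sqrt (P Q)], which
    [cut_paste] carries over to the pair 01, 10. Then [(v - w)^2 <= 2 (u - v)^2 + 2 (u - w)^2]. *)
Lemma hellinger_cut_paste d i :
  hellinger (hard_fibre d i false false) (hard_fibre d i true true) <=
  2 * hellinger (hard_fibre d i false false) (hard_fibre d i true false) +
  2 * hellinger (hard_fibre d i false false) (hard_fibre d i false true).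
Proof.
pose g a b m := Num.sqrt (hard_fibre d i a b m).
have gg m : g false false m * g true true m = g false true m * g true false m.
  by rewrite /g -!sqrtrM ?hard_fibre_ge0 // cut_paste.
have sq a b : \sum_m g a b m ^+ 2 = #|{: cube}|%:R.
  have := sum_hard_fibre d i a b (fun=> 1).
  rewrite sumr_const => <-; apply: eq_bigr => m _.
  by rewrite mul1r sqr_sqrtr ?hard_fibre_ge0.
have expand a b a' b' : \sum_m (g a b m - g a' b' m) ^+ 2 =
    2 * #|{: cube}|%:R - 2 * \sum_m g a b m * g a' b' m.
  rewrite mulr_natl mulr2n -{1}(sq a b) -(sq a' b') -big_split /= mulr_sumr.
  by rewrite -sumrB; apply: eq_bigr => m _; ring.
have -> : hellinger (hard_fibre d i false false) (hard_fibre d i true true) =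
    \sum_m (g false true m - g true false m) ^+ 2.
  rewrite [LHS]expand expand; congr (_ - _ * _).
  by apply: eq_bigr => m _; exact: gg.
rewrite /hellinger !mulr_sumr -big_split; apply: ler_sum => m _ /=.
rewrite -!/(g _ _ m); set u := g false false m.
set v := g true false m; set w := g false true m.
have := sqr_ge0 (v + w - 2 * u); rewrite -subr_ge0 => h.
by rewrite -subr_ge0; move: h; congr (_ <= _); ring.
Qed.

Lemma advantage_hellinger d i (acc : pred F) :
  \sum_z ((acc (hard_output d i false false z))%:R -
          (acc (hard_output d i true true z))%:R) <=
  100 * hellinger (hard_fibre d i false false) (hard_fibre d i true true) +
  100^-1 * #|{: cube}|%:R.
Proof.
rewrite sumrB -!(sum_hard_fibre _ _ _ _ (fun m => (acc m)%:R)) -sumrB.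
pose P := hard_fibre d i false false; pose Q := hard_fibre d i true true.
(* Prepares the termwise bound [(u + v)^2 / 400 <= (u^2 + v^2) / 200]. *)
have -> : 100^-1 * #|{: cube}|%:R = 200^-1 * \sum_m (P m + Q m).
  have s a b : \sum_m hard_fibre d i a b m = #|{: cube}|%:R.
    have := sum_hard_fibre d i a b (fun=> 1); rewrite sumr_const => <-.
    by apply: eq_bigr => m _; rewrite mul1r.
  by rewrite big_split /= !s; field.
rewrite /hellinger !mulr_sumr -big_split; apply: ler_sum => m _ /=.
rewrite -/P -/Q; have := hard_fibre_ge0 d i false false m; rewrite -/P => P0.
have := hard_fibre_ge0 d i true true m; rewrite -/Q => Q0.
have := sqr_sqrtr P0; have := sqr_sqrtr Q0.
set u := Num.sqrt (P m); set v := Num.sqrt (Q m) => <- <-.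
(* AM-GM: [|u^2 - v^2| <= 100 (u - v)^2 + (u + v)^2 / 400]. *)
have h1 := sqr_ge0 (10 * (u - v) - 20^-1 * (u + v)).
have h2 := sqr_ge0 (10 * (u - v) + 20^-1 * (u + v)).
have h3 := sqr_ge0 (u - v).
case: (acc m); rewrite ?mul1r ?mul0r; nra.
Qed.

Lemma total_hellinger (L : R) : #|F|%:R <= expR L ->
  \sum_i \sum_d
    hellinger (hard_fibre d i false false) (hard_fibre d i true true) <=
  64 * #|{: cube}|%:R ^+ 2 * L.
Proof.
move=> FL.
pose H i d := hellinger (fibre_at (masked_output d) i false)
                        (fibre_at (masked_output d) i true).
apply: (@le_trans _ _ (\sum_i (4 * \sum_d H i d))).
  apply: ler_sum => i _.
  have -> : 4 * \sum_d H i d = 2 * (2 * \sum_d H i d) by ring.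
  (* Pairing the two values of [d i] matches Bob's and Alice's terms, each of which fixes [d i]. *)
  rewrite -(sum_upd (H i) i) mulr_sumr; apply: ler_sum => d _.
  apply: (le_trans (hellinger_cut_paste d i)); rewrite mulrDr addrC.
  rewrite le_eqVlt; apply/orP; left; apply/eqP; rewrite /H /hellinger.
  by congr (_ * _ + _ * _); apply: eq_bigr => m _;
    rewrite -?hard_fibre_alice -?hard_fibre_bob.
rewrite -mulr_sumr exchange_big /=.
have -> : 64 * #|{: cube}|%:R ^+ 2 * L =
    4 * (\sum_(d : cube) 16 * #|{: cube}|%:R * L) :> R.
  by rewrite sumr_const -[_ *+ _]mulr_natl; ring.
rewrite ler_pM2l //; apply: ler_sum => d _.
exact: hellinger_fibre_at_le.
Qed.

Lemma total_advantage (L : R) (acc : pred F) : #|F|%:R <= expR L ->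
  \sum_i \sum_d \sum_z ((acc (hard_output d i false false z))%:R -
                        (acc (hard_output d i true true z))%:R) <=
  #|{: cube}|%:R ^+ 2 * (6400 * L + 100^-1 * #|I|%:R).
Proof.
move=> FL.
apply: (@le_trans _ _ (\sum_i \sum_(d : cube) (100 * hellinger
   (hard_fibre d i false false) (hard_fibre d i true true) +
  100^-1 * #|{: cube}|%:R))).
  by apply: ler_sum => i _; apply: ler_sum => d _; exact: advantage_hellinger.
under eq_bigr do rewrite big_split -mulr_sumr /=.
rewrite big_split -mulr_sumr /= !sumr_const -[_ *+ #|I|]mulr_natl.
rewrite -[_ *+ #|{: cube}|]mulr_natl.
have := total_hellinger FL; set S := \sum_i _; lra.
Qed.

End CutAndPaste.
End Cube.

(** * Zero and positive optimal cost *)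

Section ZeroCost.
Variables (T : finType) (sim : rel T).

Lemma card2_in_edges (V : {set T}) u v :
  u \in V -> v \in V -> u != v -> [set u; v] \in edges V.
Proof. by move=> uV vV uv; rewrite inE cards2 uv subUset !sub1set uV vV. Qed.

Lemma opt_cost_clique (V : {set T}) : V != set0 ->
  {in V &, forall u v, u != v -> sim u v} -> opt_cost sim V = 0%N.
Proof.
move=> V0 simV; apply/eqP; rewrite -leqn0.
have PV : partition [set V] V.
  rewrite /partition /cover big_set1 eqxx /= in_set1 eq_sym V0 andbT.
  by apply/trivIsetP => B C /set1P -> /set1P ->; rewrite eqxx.
apply: leq_trans (opt_cost_le sim PV) _.
have plus e : e \in edges V -> plus_edge sim e.
  rewrite inE => /andP[/subsetP eV _].
  apply/forall_inP => u ue; apply/forall_inP => v ve; apply/implyP.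
  by apply: simV; apply: eV.
have ins e : e \in edges V -> inside [set V] e.
  rewrite inE => /andP[eV _]; apply/existsP; exists V.
  by rewrite set11.
rewrite leqn0 addn_eq0 !cards_eq0; apply/andP; split; apply/eqP/setP => e;
  rewrite in_set in_set0; apply/negbTE/negP => /andP[eE /andP[]].
  by rewrite (ins e eE).
by rewrite (plus e eE).
Qed.

(** A bad triangle: at cost 0, [u] and [v] would both share the cluster of [w], although they are
    dissimilar. *)
Lemma opt_cost_gt0 (V : {set T}) u v w : symmetric sim ->
  u \in V -> v \in V -> w \in V -> u != v -> u != w -> v != w ->
  sim u w -> sim v w -> ~~ sim u v -> (0 < opt_cost sim V)%N.
Proof.
move=> simC uV vV wV uv uw vw suw svw suv.
have [P PV ->] := opt_cost_attained sim V.
rewrite lt0n addn_eq0 !cards_eq0; apply/negP => /andP[/eqP cut0 /eqP ins0].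
have together a b : a \in V -> b \in V -> a != b -> sim a b ->
    exists2 C, C \in P & (a \in C) && (b \in C).
  move=> aV bV ab sab; have /setP/(_ [set a; b]) := cut0.
  rewrite in_set in_set0 card2_in_edges //=.
  have -> : plus_edge sim [set a; b].
    apply/forall_inP => s /set2P[] ->; apply/forall_inP => t /set2P[] ->;
      by rewrite ?eqxx ?sab ?(simC b) ?sab ?implybT.
  move/negbFE/existsP => [C /andP[CP]]; rewrite subUset !sub1set => abC.
  by exists C.
have [C CP /andP[uC wC]] := together u w uV wV uw suw.
have [D DP /andP[vD wD]] := together v w vV wV vw svw.
have /and3P[_ tP _] := PV.
have CD : D = C by rewrite -(def_pblock tP DP wD) (def_pblock tP CP wC).
have /setP/(_ [set u; v]) := ins0.
rewrite in_set in_set0 card2_in_edges //=.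
have -> : inside P [set u; v].
  by apply/existsP; exists C; rewrite CP subUset !sub1set uC -CD.
rewrite andbT => /negbFE /forall_inP /(_ u (set21 u v)) /forall_inP.
by move=> /(_ v (set22 u v)); rewrite uv (negPf suv).
Qed.

End ZeroCost.

(** * Streams encoding set disjointness *)

Section HardInstance.
Variables (k r : nat) (T : finType) (node : 'I_k * bool * bool + 'I_r -> T).
Hypothesis node_inj : injective node.
Implicit Types x y : {ffun 'I_k -> bool}.

(* [node (inl (j, b, v))] is the node that Alice ([b = false]) or Bob
   ([b = true]) inserts when the j-th input bit is [v]; the nodes
   [node (inr l)] are always present and only adjust the stream length. *)
Definition hard_sim : rel T := fun s t =>
  ~~ [exists j, ((s == node (inl (j, false, true))) &&
                 (t == node (inl (j, true, true)))) ||
                ((t == node (inl (j, false, true))) &&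
                 (s == node (inl (j, true, true))))].

Definition alice_part (x : {ffun 'I_k -> bool}) : seq T :=
  [seq node (inl (j, false, x j)) | j <- enum 'I_k].
Definition bob_part (y : {ffun 'I_k -> bool}) : seq T :=
  [seq node (inl (j, true, y j)) | j <- enum 'I_k] ++
  [seq node (inr l) | l <- enum 'I_r].
Definition hard_stream x y : seq T := alice_part x ++ bob_part y.

Lemma size_alice_part x : size (alice_part x) = k.
Proof. by rewrite size_map size_enum_ord. Qed.

Lemma size_bob_part y : size (bob_part y) = (k + r)%N.
Proof. by rewrite /bob_part size_cat 2!size_map !size_enum_ord. Qed.

Lemma size_hard_stream x y : size (hard_stream x y) = (k + (k + r))%N.
Proof. by rewrite size_cat size_alice_part size_bob_part. Qed.

Lemma hard_sim_sym : symmetric hard_sim.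
Proof.
by move=> s t; congr (~~ _); apply: eq_existsb => j; rewrite orbC.
Qed.

Lemma uniq_hard_stream x y : uniq (hard_stream x y).
Proof.
have disj (U V : eqType) (g : U -> _) (h : V -> _) s t :
    (forall u v, g u <> h v) ->
    ~~ has (mem [seq node (g u) | u <- s]) [seq node (h v) | v <- t].
  move=> gh; rewrite -all_predC; apply/allP => _ /mapP[v _ ->].
  by apply/negP => /mapP[u _ /node_inj /esym]; exact: gh.
rewrite /hard_stream /bob_part !cat_uniq has_cat negb_or !disj //.
have uniq_node (U : finType) (g : U -> _) :
    injective g -> uniq [seq node (g u) | u <- enum U].
  by move=> g_inj; rewrite map_inj_uniq ?enum_uniq // => i j /node_inj /g_inj.
by rewrite !uniq_node // => i j [].
Qed.

Lemma alice_in_stream x y j : node (inl (j, false, x j)) \in hard_stream x y.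
Proof.
rewrite mem_cat; apply/orP; left.
by apply: (map_f (fun j => node (inl (j, false, x j)))); rewrite mem_enum.
Qed.

Lemma bob_in_stream x y j : node (inl (j, true, y j)) \in hard_stream x y.
Proof.
rewrite !mem_cat; apply/orP; right; apply/orP; left.
by apply: (map_f (fun j => node (inl (j, true, y j)))); rewrite mem_enum.
Qed.

Lemma mem_hard_stream x y j b :
  node (inl (j, b, true)) \in hard_stream x y -> (if b then y j else x j).
Proof.
rewrite !mem_cat => /or3P[] /mapP[i _ /node_inj] //.
  by case=> -> -> <-.
by case=> -> -> <-.
Qed.

Lemma opt_cost_disjoint x y : (0 < k)%N -> (forall j, ~~ (x j && y j)) ->
  opt_cost hard_sim [set t in hard_stream x y] = 0%N.
Proof.
move=> k0 dis; apply: opt_cost_clique.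
  apply/set0Pn; exists (node (inl (Ordinal k0, false, x (Ordinal k0)))).
  by rewrite inE alice_in_stream.
move=> u v; rewrite !inE => uS vS _; apply/existsPn => j.
rewrite negb_or; apply/andP; split;
  apply: contra (dis j) => /andP[/eqP e1 /eqP e2];
  move: uS vS; rewrite e1 e2 => /mem_hard_stream /= h1 /mem_hard_stream /= h2;
  by rewrite ?h1 ?h2.
Qed.

(** The third vertex of the bad triangle is Alice's node at another coordinate, available since
    [k > 1]. *)
Lemma opt_cost_intersect x y i : (1 < k)%N -> x i -> y i ->
  (0 < opt_cost hard_sim [set t in hard_stream x y])%N.
Proof.
move=> k1 xi yi.
have [j ji] : exists j : 'I_k, j != i.
  have k0 := ltnW k1; have [e|] := eqVneq i (Ordinal k0); last first.
    by exists (Ordinal k0); rewrite eq_sym.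
  by exists (Ordinal k1); rewrite e.
pose u := node (inl (i, false, true)); pose v := node (inl (i, true, true)).
pose w := node (inl (j, false, x j)).
have eq1 a b : (node a == node b) = (a == b) by rewrite (inj_eq node_inj).
apply: (@opt_cost_gt0 _ _ _ u v w hard_sim_sym); rewrite ?inE /u /v /w ?eq1 //.
- by have := alice_in_stream x y i; rewrite xi.
- by have := bob_in_stream x y i; rewrite yi.
- exact: alice_in_stream.
- by apply/eqP => -[].
- by apply/eqP => -[ij]; rewrite ij eqxx in ji.
- by apply/eqP => -[].
- apply/existsPn => l; rewrite !eq1.
  by apply/negP => /orP[] /andP[/eqP e1 /eqP e2].
- apply/existsPn => l; rewrite !eq1.
  apply/negP => /orP[] /andP[/eqP e1 /eqP e2] //.
  by move: e1 e2 => [lj _] [li]; rewrite lj li eqxx in ji.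
- by rewrite /hard_sim negbK; apply/existsP; exists i; rewrite !eqxx.
Qed.

End HardInstance.

(** * Streaming passes as a two-party protocol *)

Section AlternatingProtocol.
Variables (X Y mem : Type).
Variables (stepA : nat -> mem -> X -> mem) (stepB : nat -> mem -> Y -> mem).

Fixpoint transcript p l m x y : seq (mem * mem) :=
  if p is p'.+1 then
    let a := stepA l m x in let b := stepB l a y in
    (a, b) :: transcript p' l.+1 b x y
  else [::].

Lemma size_transcript p l m x y : size (transcript p l m x y) == p.
Proof. by elim: p l m => //= p IH l m; rewrite eqSS. Qed.

(** Equal transcripts hand over the same memory at every turn, so neither party notices a change of
    the other's input. *)
Lemma transcript_rect p l m x y x' y' :
  transcript p l m x y = transcript p l m x' y' ->
  transcript p l m x y' = transcript p l m x y.
Proof.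
elim: p l m => //= p IH l m [ea eb et].
by rewrite -ea in eb et *; rewrite -eb in et *; rewrite (IH _ _ et).
Qed.

End AlternatingProtocol.

Section Streaming.
Variables (R : realType) (T : finType) (A : stream_alg R T) (sim : rel T).
Variable (w : seed A).
Local Notation mem := ((space_bits A).-tuple bool).

Definition run o (m : mem) (s : seq T) : mem :=
  foldl (fun m tx => step sim w tx.1 tx.2 m) m (zip (iota o (size s)) s).

Lemma run_cat o m s t : run o m (s ++ t) = run (o + size s)%N (run o m s) t.
Proof.
by rewrite /run size_cat iotaD zip_cat ?size_iota // foldl_cat.
Qed.

Section TwoParties.
Variables (X Y : Type) (a : X -> seq T) (b : Y -> seq T) (n1 n2 : nat).
Hypotheses (size_a : forall x, size (a x) = n1)
           (size_b : forall y, size (b y) = n2).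

(** The clock reads [l * (n1 + n2)] when pass [l] starts and [n1] more when Bob takes over. *)
Definition memories p l m x y :=
  transcript (fun l m x => run (l * (n1 + n2)) m (a x))
             (fun l m y => run (l * (n1 + n2) + n1) m (b y)) p l m x y.

Lemma run_passes p l m x y :
  run (l * (n1 + n2)) m (flatten (nseq p (a x ++ b y))) =
  last m (map snd (memories p l m x y)).
Proof.
elim: p l m => //= p IH l m.
by rewrite !run_cat size_cat size_a size_b addnC -mulSn IH.
Qed.

Definition memory_tuple x y : (passes A).-tuple (mem * mem) :=
  Tuple (size_transcript _ _ _ _ _ _ _ :
    size (memories (passes A) 0 (init sim w) x y) == passes A).

Lemma estimate_memory_tuple x y :
  estimate sim w (a x ++ b y) =
  output sim w (last (init sim w) (map snd (memory_tuple x y))).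
Proof.
rewrite /estimate; congr output; exact: (run_passes (passes A) 0).
Qed.

Lemma memory_tuple_rect x y x' y' :
  memory_tuple x y = memory_tuple x' y' -> memory_tuple x y' = memory_tuple x y.
Proof.
by move=> h; apply: val_inj; exact: transcript_rect (congr1 val h).
Qed.

End TwoParties.
End Streaming.

(** * Estimate 0 as a test for cost 0 *)

Section ErrorProb.
Variables (R : realType) (T : finType) (A : stream_alg R T) (sim : rel T).
Variables (c : R) (st : seq T).
Local Notation X := (opt_cost sim [set t in st]).
Local Notation zero_prob :=
  (\sum_(w : seed A) seed_prob w * (estimate sim w st == 0)%:R).

(** At cost 0 the admissible interval from 0 to [c * 0] is a single point, whatever [c] is. *)
Lemma zero_prob_ge : X = 0%N -> 1 - error_prob A sim c 0 st <= zero_prob.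
Proof.
move=> X0; rewrite -[X in X - _](seed_prob_sum1 A) /error_prob.
rewrite [X in _ - X]big_mkcond /= -sumrB.
apply: ler_sum => w _; rewrite X0 /approximates mulr0 addr0 -eq_le eq_sym.
by case: eqP => _ /=; rewrite ?mulr0 ?mulr1 ?subrr ?subr0.
Qed.

Lemma zero_prob_le : (0 < X)%N -> zero_prob <= error_prob A sim c 0 st.
Proof.
move=> X0; rewrite /error_prob [leRHS]big_mkcond /=.
apply: ler_sum => w _; case: eqP => [->|_] /=.
  by rewrite /approximates lern0 -leqn0 leqNgt X0 /= mulr1.
by rewrite mulr0; case: ifP => // _; exact: seed_prob_ge0.
Qed.

End ErrorProb.

(** * From disjointness to the space bound *)

Lemma inj_of_card (U T : finType) : (#|U| <= #|T|)%N ->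
  exists f : U -> T, injective f.
Proof.
move=> le; exists (fun u => enum_val (widen_ord le (enum_rank u))) => u v.
by move=> /enum_val_inj /(congr1 val) /= /val_inj /enum_rank_inj.
Qed.

Lemma card_memory_tuple_le (R : realType) (s p : nat) :
  #|{: p.-tuple (s.-tuple bool * s.-tuple bool)}|%:R <=
  expR ((2 * s * p)%:R : R).
Proof.
rewrite card_tuple card_prod card_tuple card_bool -expnD addnn -muln2 (mulnC s).
rewrite -expnM natrX -[_%:R in leRHS]mulr1 expRM_natl.
rewrite lerXn2r ?nnegrE ?expR_ge0 //.
by apply: le_trans (expR_ge1Dx 1); rewrite -natr1.
Qed.

(** Averaged over seeds the test gains at least 1/50 at every [(i, d, z)], so [total_advantage],
    applied seed by seed, gives [k / 50 <= 6400 L + k / 100]. *)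
Lemma disjointness_space (R : realType) (c : R) (k r : nat) (T : finType)
    (A : stream_alg R T) :
  (1 < k)%N -> (4 * k + r <= #|T|)%N ->
  (forall (sim : rel T) (st : (k + (k + r)).-tuple T),
     symmetric sim -> uniq st ->
     error_prob A sim c 0 st <= 49%:R / 100%:R) ->
  k%:R <= 100 * 6400 * (2 * space_bits A * passes A)%:R :> R.
Proof.
(* The gap is [1 - 2 * 0.49 = 1/50]. *)
have separate (e0 e1 s0 s1 : R) :
    e0 <= 49%:R / 100%:R -> e1 <= 49%:R / 100%:R ->
    1 - e0 <= s0 -> s1 <= e1 -> 50^-1 <= s0 - s1 by lra.
move=> k1 kT err; pose L : R := (2 * space_bits A * passes A)%:R.
have [node node_inj] : exists f : 'I_k * bool * bool + 'I_r -> T, injective f.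
  apply: inj_of_card; rewrite card_sum !card_prod !card_ord card_bool.
  by rewrite -mulnA mulnC.
pose sim := hard_sim node; pose st x y := hard_stream node x y.
have errst x y : error_prob A sim c 0 (st x y) <= 49%:R / 100%:R.
  have sz : size (st x y) == (k + (k + r))%N by rewrite size_hard_stream.
  apply: (err sim (Tuple sz)); first exact: hard_sim_sym.
  exact: uniq_hard_stream.
pose f (w : seed A) :=
  memory_tuple sim w (alice_part node) (bob_part node) k (k + r).
pose mem := (space_bits A).-tuple bool.
pose acc (w : seed A) (t : (passes A).-tuple (mem * mem)) :=
  output sim w (last (init sim w) (map snd t)) == 0.
have accE w x y : acc w (f w x y) = (estimate sim w (st x y) == 0).
  by rewrite /acc -estimate_memory_tuple //;
    [exact: size_alice_part | exact: size_bob_part].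
pose I := 'I_k; pose cube := {ffun I -> bool}.
have gap (i : I) (d z : cube) : 50^-1 <= \sum_(w : seed A) seed_prob w *
    ((acc w (hard_output (f w) d i false false z))%:R -
     (acc w (hard_output (f w) d i true true z))%:R).
  under eq_bigr do rewrite mulrBr !accE.
  rewrite sumrB.
  set x0 := upd _ i false; set y0 := upd _ i false.
  set x1 := upd _ i true; set y1 := upd _ i true.
  have lo := @zero_prob_ge R T A sim c (st x0 y0)
    (opt_cost_disjoint node_inj (ltnW k1) _).
  have hi := @zero_prob_le R T A sim c (st x1 y1)
    (opt_cost_intersect (i := i) node_inj k1 _ _).
  (* Off [i], the mask [d] gives each bit to one party only. *)
  have dis j : ~~ (x0 j && y0 j).
    by rewrite !ffunE; case: eqP => // _; case: (d j); rewrite // andbF.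
  have x1i : x1 i by rewrite ffunE eqxx.
  have y1i : y1 i by rewrite ffunE eqxx.
  exact: separate (errst x0 y0) (errst x1 y1) (lo dis) (hi x1i y1i).
have total : \sum_(i : I) \sum_(d : cube) \sum_(z : cube) 50^-1 <=
    #|{: cube}|%:R ^+ 2 * (6400 * L + 100^-1 * #|I|%:R) :> R.
  apply: (@le_trans _ _ (\sum_(w : seed A) seed_prob w *
    \sum_(i : I) \sum_(d : cube) \sum_(z : cube)
     ((acc w (hard_output (f w) d i false false z))%:R -
     (acc w (hard_output (f w) d i true true z))%:R))).
    under [leRHS]eq_bigr do rewrite mulr_sumr.
    rewrite [leRHS]exchange_big /=; apply: ler_sum => i _.
    under [leRHS]eq_bigr do rewrite mulr_sumr.
    rewrite [leRHS]exchange_big /=; apply: ler_sum => d _.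
    under [leRHS]eq_bigr do rewrite mulr_sumr.
    by rewrite [leRHS]exchange_big /=; apply: ler_sum => z _.
  set B := leRHS; have -> : B = \sum_(w : seed A) seed_prob w * B.
    by rewrite -mulr_suml seed_prob_sum1 mul1r.
  apply: ler_sum => w _.
  apply: ler_wpM2l; first exact: seed_prob_ge0.
  apply: (@total_advantage R _ _ (f w) _ L (acc w)).
    by move=> x y x' y'; apply: memory_tuple_rect.
  exact: card_memory_tuple_le.
have cube0 : 0 < #|{: cube}|%:R :> R.
  by rewrite card_ffun card_bool ltr0n expn_gt0.
have sumE : \sum_(i : I) \sum_(d : cube) \sum_(z : cube) 50^-1 =
    #|{: cube}|%:R ^+ 2 * (50^-1 * #|I|%:R) :> R.
  by rewrite !sumr_const -!mulrnA -[LHS]mulr_natr !natrM; ring.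
move: total; rewrite sumE.
rewrite ler_pM2l ?exprn_gt0 // card_ord -/L.
by move: L k%:R => {}L kR; lra.
Qed.

Theorem theorem4 (R : realType) (c : R) (p : nat) (hc : 1 <= c) :
  exists2 delta : R, 0 < delta &
  exists n0 : nat, forall (n : nat) (T : finType) (A : stream_alg R T),
    (n0 <= n)%N -> (2 * n <= #|T|)%N -> (passes A <= p)%N ->
    (forall (sim : rel T) (st : n.-tuple T), symmetric sim -> uniq st ->
       error_prob A sim c 0 st <= 49%:R / 100%:R) ->
    delta * n%:R <= (space_bits A)%:R.
Proof.
(* Here 600 is 100 times 2 from the transcript length times 3 from [n <= 3 k]; [p.+1] keeps the
   constant positive for [p = 0]. *)
exists (600 * 6400 * p.+1%:R)^-1; first by rewrite invr_gt0 !mulr_gt0.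
exists 4%N => n T A n4 nT Ap err.
(* One padding node absorbs odd [n]; [n >= 4] ensures [k > 1]. *)
pose k := n./2; pose r : nat := odd n.
have nE : n = (k + (k + r))%N by rewrite addnA addnn addnC odd_double_half.
have k1 : (1 < k)%N by rewrite (half_leq n4).
have kT : (4 * k + r <= #|T|)%N.
  by apply: leq_trans nT; rewrite nE; lia.
have n3 : (n <= 3 * k)%N by rewrite nE /r; case: (odd n); lia.
rewrite ler_pdivrMl ?mulr_gt0 //.
have sp :
    (2 * space_bits A * passes A)%:R <= (2 * (space_bits A * p.+1))%:R :> R.
  by rewrite ler_nat -mulnA leq_mul2l leq_mul2l (leqW Ap) orbT.
have : k%:R <= 100 * 6400 * (2 * space_bits A * passes A)%:R :> R.
  apply: (@disjointness_space R c k r T A) => //.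
  by rewrite -nE.
move: n3; rewrite -(ler_nat R) natrM => n3 kle.
apply: (le_trans n3); move: sp; rewrite !natrM; lra.
Qed.
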